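(* Let $S$ be a program (possibly containing while loops) with control-flow graph $G$ and unrolled control-flow graph $H$. Let $N_1,\dots,N_K$ be all sample nodes in $G$, where $N_k=\mathrm{Assign}(x_k=\mathtt{sample}(E_0^k,f^k(E_1^k,\dots,E_{n_k}^k)))$, and for each $k$ let $$A_k=\mathrm{addresses}(N_k)\cup\bigcup_{i=0}^{n_k}\mathrm{prov}(N_k,E_i^k)\cup\bigcup_{N'\in \mathrm{BP}(N_k)}\mathrm{prov}(N',\mathrm{condexp}(N')),$$ all computed in $G$. Then there exist functions $p_k\in[\mathcal T|_{A_k}\to\mathbb R_{\ge 0}]$, $k=1,\dots,K$, such that for all traces $\mathtt{tr}\in\mathcal T$, if $p_S(\mathtt{tr})\neq$ undefined, then $$p_S(\mathtt{tr})=p_G(\mathtt{tr})=p_H(\mathtt{tr})=\prod_{k=1}^K p_k(\mathtt{tr}).$$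
   Context: **Language.** $\mathcal V$ is the set of values (booleans, integers, reals, real vectors, finite strings, and a special value $\mathtt{null}$); $\mathbf{Strings}\subset\mathcal V$ is the set of finite strings (addresses). Expressions: $E::=c\mid x\mid g(E_1,\dots,E_n)$ with $c\in\mathcal V$ a constant, $x$ a program variable (finitely many), $g$ a built-in total function on values. $\mathrm{vars}(E)$ is the set of program variables in $E$. Statements: $S::= x=E\mid S_1;S_2\mid \mathtt{if}\,E\,\mathtt{then}\,S_1\,\mathtt{else}\,S_2\mid\mathtt{skip}\mid\mathtt{while}\,E\,\mathtt{do}\,S\mid x=\mathtt{sample}(E_0,f(E_1,\dots,E_n))$, with $f$ a built-in distribution having a function $\mathrm{pdf}_f(v;v_1,\dots,v_n)\in\mathbb R_{\ge0}$. The address expression $E_0$ is assumed to evaluate to a string. A program is a statement. **Traces and states.** A trace is a map $\mathtt{tr}:\mathbf{Strings}\to\mathcal V$; $\mathcal T$ is the set of all traces. A state $\sigma\in\Sigma$ assigns a value to every program variable and a number in $\mathbb R_{\ge0}$ to a reserved variable $\mathbf p$ (not a program variable, not occurring in programs); it is lifted to expressions by $\sigma(c)=c$, $\sigma(g(E_1,\dots,E_n))=g(\sigma(E_1),\dots,\sigma(E_n))$. **Program semantics.** For each trace, $(\sigma,S)\Downarrow^{\mathtt{tr}}\sigma'$ is the least relation closed under: $(\sigma,\mathtt{skip})\Downarrow\sigma$; $(\sigma,x=E)\Downarrow\sigma[x\mapsto\sigma(E)]$; sequencing; $\mathtt{if}$ executes $S_1$ if $\sigma(E)=\mathtt{true}$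 and $S_2$ if $\sigma(E)=\mathtt{false}$; $\mathtt{while}\,E\,\mathtt{do}\,S$ leaves $\sigma$ unchanged if $\sigma(E)=\mathtt{false}$ and executes $S;\mathtt{while}\,E\,\mathtt{do}\,S$ if $\sigma(E)=\mathtt{true}$; and if $V_i=\sigma(E_i)\ne\mathtt{null}$ for all $i=0,\dots,n$, $V_0\in\mathbf{Strings}$, $V=\mathtt{tr}(V_0)\neq\mathtt{null}$, then $(\sigma,x=\mathtt{sample}(E_0,f(E_1,\dots,E_n)))\Downarrow\sigma[x\mapsto V,\mathbf p\mapsto\sigma(\mathbf p)\cdot\mathrm{pdf}_f(V;V_1,\dots,V_n)]$. With $\sigma_0$ mapping all program variables to $\mathtt{null}$ and $\mathbf p$ to $1$, $p_S(\mathtt{tr})=\sigma(\mathbf p)$ if $(\sigma_0,S)\Downarrow^{\mathtt{tr}}\sigma$ for some $\sigma$, and undefined otherwise. **CFG.** The control-flow graph $G$ of $S$ is a directed graph with one START, one END node, and branch nodes $\mathrm{Branch}(E)$, join nodes, assign nodes $\mathrm{Assign}(x=E)$ and sample nodes $\mathrm{Assign}(x=\mathtt{sample}(\dots))$ (sample nodes are also assign nodes). Every occurrence of a statement yields its own nodes. $\mathtt{skip}$: START$\to$END. Assignment/sample: START$\to$Assign$\to$END. $S_1;S_2$: remove END of $G_1$ and START of $G_2$ and connect the predecessor of END in $G_1$ to the successor of START in $G_2$. $\mathtt{if}\,E$: START$\to B=\mathrm{Branch}(E)$; $B$ has successors consequent$(B)$ = first node of (the interior of) $G_1$, alternative$(B)$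 = first node of $G_2$; the last nodes of $G_1$, $G_2$ go to a join node $J$; $J\to$END (a $\mathtt{skip}$ branch is a direct edge $B\to J$). $\mathtt{while}\,E\,\mathtt{do}\,S'$: START$\to B=\mathrm{Branch}(E)$; consequent$(B)$ is the first node of $G_{S'}$, alternative$(B)=J$ (join node); the last node of $G_{S'}$ goes back to $B$; $J\to$END (if $S'=\mathtt{skip}$, an edge $B\to B$). In both cases $(B,J)\in\mathrm{BranchJoin}(G)$ and $\mathrm{condexp}(B)=E$. **Unrolled CFG.** $H$ is built by the same rules except for $\mathtt{while}\,E\,\mathtt{do}\,S'$: for every $i\in\mathbb N$, $i\geq1$, take a branch node $B_i=\mathrm{Branch}(E)$ and a copy $H_i$ of the unrolled CFG of $S'$, and a single join node $J$; edges START$\to B_1$, consequent$(B_i)$ = first node of $H_i$, alternative$(B_i)=J$, last node of $H_i\to B_{i+1}$, $J\to$END (if $S'=\mathtt{skip}$, edges $B_i\to B_{i+1}$); $(B_i,J)\in\mathrm{BranchJoin}(H)$ for all $i$. **Graph semantics.** Transitions $(\sigma,N)\xrightarrow{\mathtt{tr}}(\sigma',N')$: START and join nodes move to their successor with $\sigma'=\sigma$; $\mathrm{Assign}(x=E)$ moves to its successor with $\sigma'=\sigma[x\mapsto\sigma(E)]$; sample nodes move to their successor with $\sigma'$ as in the sample rule above (under the same conditions); $\mathrm{Branch}(E)$ moves with $\sigma'=\sigma$ to consequent if $\sigma(E)=\mathtt{true}$, to alternative if $\sigma(E)=\mathtt{false}$. $p_G(\mathtt{tr})=\sigma(\mathbf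 p)$ if there is a finite transition sequence from $(\sigma_0,\mathrm{START})$ to $(\sigma,\mathrm{END})$ in $G$, undefined otherwise; $p_H$ likewise. **Provenance.** $\mathrm{RD}(N,x)$ is the set of assign nodes $N'$ assigning $x$ (including sample nodes) for which there is a path $(N',N_1,\dots,N_n,N)$, $n\ge0$, with no $N_i$ assigning $x$. $\mathrm{BP}(N)=\{B:(B,J)\in\mathrm{BranchJoin},\ \exists\text{ path }(B,\dots,N,\dots,J)\}$, the path running inside the sub-graph (including $B,J$) created for the if/while statement to which $B,J$ belong. For a sample node with address expression $E_0$, $\mathrm{addresses}(N)=\{\sigma(E_0):\sigma\in\Sigma\}\cap\mathbf{Strings}$. $\mathrm{prov}(N,x)$: let $R$ be the least set of pairs containing $(N,x)$ such that whenever $(M,z)\in R$ and $N'\in\mathrm{RD}(M,z)$, then (i) $(N',y)\in R$ for all $y\in\mathrm{vars}(E')$, where $E'=E$ if $N'=\mathrm{Assign}(z=E)$ and $E'=E_0$ if $N'=\mathrm{Assign}(z=\mathtt{sample}(E_0,\dots))$; (ii) $(B,y)\in R$ for all $B\in\mathrm{BP}(N')$, $y\in\mathrm{vars}(\mathrm{condexp}(B))$. Then $\mathrm{prov}(N,x)$ is the union of $\mathrm{addresses}(N')$ over all sample nodes $N'\in\mathrm{RD}(M,z)$ with $(M,z)\in R$. For expressions, $\mathrm{prov}(N,E)=\bigcup_{y\in\mathrm{vars}(E)}\mathrm{prov}(N,y)$. **Restricted functions.** For $A\subseteq\mathbf{Strings}$ and a set $C$, $[\mathcal T|_A\to C]$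 is the set of functions $h:\mathcal T\to C$ such that $h(\mathtt{tr})=h(\mathtt{tr}')$ whenever $\mathtt{tr}(\alpha)=\mathtt{tr}'(\alpha)$ for all $\alpha\in A$. *)

(* Defs.v *)
From Stdlib Require String.
From mathcomp Require Import all_boot all_order all_algebra interval_inference.
From mathcomp Require Import all_classical reals.

Set Implicit Arguments.
Unset Strict Implicit.
Unset Printing Implicit Defensive.

Import Order.TTheory GRing.Theory Num.Theory.
Local Open Scope classical_set_scope.
Local Open Scope ring_scope.

(** * Values, traces *)

Notation address := String.string.

Inductive value (R : realType) : Type :=
| VBool of bool
| VInt of int
| VReal of R
| VVec n of 'rV[R]_n
| VStr of address
| VNull.
Arguments VBool {R}.
Arguments VInt {R}.
Arguments VStr {R}.
Arguments VNull {R}.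

Definition trace (R : realType) := address -> value R.

(* The built-in functions and distributions are an arbitrary signature with
   fixed arities; an argument list of length [n] is a map out of ['I_n]. *)
Record builtins (R : realType) := Builtins {
  fn : Type;
  fn_arity : fn -> nat;
  fn_sem : forall g : fn, ('I_(fn_arity g) -> value R) -> value R;
  dist : Type;
  dist_arity : dist -> nat;
  pdf : forall f : dist, value R -> ('I_(dist_arity f) -> value R) ->
          {nonneg R}
}.

(* [A]-restricted functions of the trace, i.e. the set [T|_A -> C]. *)
Definition restricted (R : realType) (A : set address) (C : Type) :
    set (trace R -> C) :=
  [set h | forall tr tr' : trace R,
             (forall a, A a -> tr a = tr' a) -> h tr = h tr'].
Arguments restricted {R} A C.

(* [is_path e n [:: n1; ...; nk]]: the walk (n, n1, ..., nk) follows [e]. *)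
Fixpoint is_path (T : Type) (e : T -> T -> Prop) (n : T) (l : seq T) : Prop :=
  if l is m :: l' then e n m /\ is_path e m l' else True.

(* Interior nodes of the graphs of if, while and unrolled while statements, from
   those of the graphs of their sub-statements. *)
Inductive if_node (I1 I2 : Type) : Type :=
| IfBranch | IfJoin | IfThen of I1 | IfElse of I2.
Arguments IfBranch {I1 I2}.
Arguments IfJoin {I1 I2}.
Arguments IfThen {I1 I2}.
Arguments IfElse {I1 I2}.

Inductive while_node (I : Type) : Type :=
| WhBranch | WhJoin | WhBody of I.
Arguments WhBranch {I}.
Arguments WhJoin {I}.
Arguments WhBody {I}.

(* Branch nodes and copies of the body are numbered from 0. *)
Inductive unrolled_node (I : Type) : Type :=
| UnBranch of nat | UnJoin | UnBody of nat & I.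
Arguments UnBranch {I}.
Arguments UnJoin {I}.
Arguments UnBody {I}.

Section Language.
Variables (R : realType) (Var : finType) (L : builtins R).

(** * Syntax *)

Inductive expr : Type :=
| Const of value R
| PVar of Var
| App (g : fn L) of ('I_(fn_arity g) -> expr).

Inductive stmt : Type :=
| SAssign of Var & expr
| SSeq of stmt & stmt
| SIf of expr & stmt & stmt
| SSkip
| SWhile of expr & stmt
| SSample (x : Var) (E0 : expr) (f : dist L) of ('I_(dist_arity f) -> expr).

Fixpoint vars (E : expr) : set Var :=
  match E with
  | Const _ => set0
  | PVar x => [set x]
  | App _ Es => \bigcup_i vars (Es i)
  end.

(** * States and program semantics *)

(* [density] is the reserved variable p. *)
Record state := State { store : Var -> value R; density : {nonneg R} }.

Fixpoint eval (s : state) (E : expr) : value R :=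
  match E with
  | Const c => c
  | PVar x => store s x
  | App g Es => fn_sem (fun i => eval s (Es i))
  end.

Definition upd (s : state) (x : Var) (v : value R) : state :=
  State (fun y => if y == x then v else store s y) (density s).

Definition scale (s : state) (q : {nonneg R}) : state :=
  State (store s) ((density s)%:num * q%:num)%:nng.

Definition init_state : state := State (fun=> VNull) 1%:nng.

Definition sample_rule (tr : trace R) (s : state) (x : Var) (E0 : expr)
    (f : dist L) (Es : 'I_(dist_arity f) -> expr) (s' : state) : Prop :=
  exists a : address,
    [/\ eval s E0 = VStr a,
        forall i, eval s (Es i) <> VNull,
        tr a <> VNull &
        s' = scale (upd s x (tr a)) (pdf (tr a) (fun i => eval s (Es i)))].

Inductive exec (tr : trace R) : state -> stmt -> state -> Prop :=
| exec_skip s : exec tr s SSkip s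
| exec_assign s x E : exec tr s (SAssign x E) (upd s x (eval s E))
| exec_seq s s' s'' S1 S2 :
    exec tr s S1 s' -> exec tr s' S2 s'' -> exec tr s (SSeq S1 S2) s''
| exec_if_true s s' E S1 S2 :
    eval s E = VBool true -> exec tr s S1 s' -> exec tr s (SIf E S1 S2) s'
| exec_if_false s s' E S1 S2 :
    eval s E = VBool false -> exec tr s S2 s' -> exec tr s (SIf E S1 S2) s'
| exec_while_false s E S :
    eval s E = VBool false -> exec tr s (SWhile E S) s
| exec_while_true s s' E S :
    eval s E = VBool true -> exec tr s (SSeq S (SWhile E S)) s' ->
    exec tr s (SWhile E S) s'
| exec_sample s s' x E0 (f : dist L) (Es : 'I_(dist_arity f) -> expr) :
    sample_rule tr s x E0 Es s' -> exec tr s (SSample x E0 Es) s'.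

(* The density of a final state satisfying [P], [None] ("undefined") if there
   is no such state.  It is only used for predicates [P] that hold of at most
   one state, as both semantics are deterministic. *)
Definition final_density (P : state -> Prop) : option {nonneg R} :=
  match pselect (exists s, P s) with
  | left h => Some (density (projT1 (cid h)))
  | right _ => None
  end.

Definition pS (S : stmt) (tr : trace R) : option {nonneg R} :=
  final_density (exec tr init_state S).

(** * Control-flow graphs *)

(* What a node other than START and END does, with its successors in [X]. *)
Inductive kind (X : Type) : Type :=
| KBranch (E : expr) (consequent alternative : X)
| KJoin (next : X)
| KAssign (x : Var) (E : expr) (next : X)
| KSample (x : Var) (E0 : expr) (f : dist L) (Es : 'I_(dist_arity f) -> expr)
    (next : X).
Arguments KSample {X} x E0 {f} Es next.

Definition kmap (X Y : Type) (h : X -> Y) (k : kind X) : kind Y :=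
  match k with
  | KBranch E c a => KBranch E (h c) (h a)
  | KJoin m => KJoin (h m)
  | KAssign x E m => KAssign x E (h m)
  | KSample x E0 f Es m => KSample x E0 Es (h m)
  end.

Definition successors (X : Type) (k : kind X) : seq X :=
  match k with
  | KBranch _ c a => [:: c; a]
  | KJoin m | KAssign _ _ m | KSample _ _ _ _ m => [:: m]
  end.

(* A graph is given by its interior, i.e. its nodes other than START and END.
   The target of an edge is [Some n] for an interior node [n] and [None] for
   END; [first] is the successor of START.  [region B] consists of the interior
   nodes created for the if/while statement that created the branch node [B]. *)
Record graph := Graph {
  inner : Type;
  first : option inner;
  kind_of : inner -> kind (option inner);
  branch_join : inner -> inner -> Prop;
  region : inner -> inner -> Prop
}.

(* Replace END by the target [e], and inject the interior nodes by [h]. *)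
Definition redirect (X Y : Type) (h : X -> Y) (e : option Y) (m : option X) :
    option Y :=
  if m is Some n then Some (h n) else e.

Definition skip_graph : graph :=
  @Graph void None (fun n => match n with end)
    (fun _ _ => False) (fun _ _ => False).

Definition single_graph (k : kind (option unit)) : graph :=
  @Graph unit (Some tt) (fun=> k) (fun _ _ => False) (fun _ _ => False).

Definition seq_graph (G1 G2 : graph) : graph :=
  let second := omap inr (first G2) in
  @Graph (inner G1 + inner G2)
    (redirect inl second (first G1))
    (fun n => match n with
              | inl n1 => kmap (redirect inl second) (kind_of n1)
              | inr n2 => kmap (omap inr) (kind_of n2)
              end)
    (fun B J => match B, J with
                | inl B', inl J' => branch_join B' J'
                | inr B', inr J' => branch_join B' J'
                | _, _ => False
                end)
    (fun B n => match B, n with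
                | inl B', inl n' => region B' n'
                | inr B', inr n' => region B' n'
                | _, _ => False
                end).

Definition if_graph (E : expr) (G1 G2 : graph) : graph :=
  let J := Some IfJoin in
  @Graph (if_node (inner G1) (inner G2))
    (Some IfBranch)
    (fun n => match n with
              | IfBranch => KBranch E (redirect IfThen J (first G1))
                                      (redirect IfElse J (first G2))
              | IfJoin => KJoin None
              | IfThen n1 => kmap (redirect IfThen J) (kind_of n1)
              | IfElse n2 => kmap (redirect IfElse J) (kind_of n2)
              end)
    (fun B J => match B, J with
                | IfBranch, IfJoin => True
                | IfThen B', IfThen J' => branch_join B' J'
                | IfElse B', IfElse J' => branch_join B' J'
                | _, _ => False
                end)
    (fun B n => match B, n with
                | IfBranch, _ => True
                | IfThen B', IfThen n' => region B' n'
                | IfElse B', IfElse n' => region B' n'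
                | _, _ => False
                end).

Definition while_graph (E : expr) (G : graph) : graph :=
  let B := Some WhBranch in
  @Graph (while_node (inner G))
    B
    (fun n => match n with
              | WhBranch => KBranch E (redirect WhBody B (first G))
                                      (Some WhJoin)
              | WhJoin => KJoin None
              | WhBody n' => kmap (redirect WhBody B) (kind_of n')
              end)
    (fun B J => match B, J with
                | WhBranch, WhJoin => True
                | WhBody B', WhBody J' => branch_join B' J'
                | _, _ => False
                end)
    (fun B n => match B, n with
                | WhBranch, _ => True
                | WhBody B', WhBody n' => region B' n'
                | _, _ => False
                end).

Definition unrolled_while_graph (E : expr) (G : graph) : graph :=
  let B i := Some (UnBranch i) in
  @Graph (unrolled_node (inner G))
    (B 0%N)
    (fun n => match n with
              | UnBranch i =>
                  KBranch E (redirect (UnBody i) (B i.+1) (first G))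
                            (Some UnJoin)
              | UnJoin => KJoin None
              | UnBody i n' => kmap (redirect (UnBody i) (B i.+1)) (kind_of n')
              end)
    (fun B J => match B, J with
                | UnBranch _, UnJoin => True
                | UnBody i B', UnBody j J' => i = j /\ branch_join B' J'
                | _, _ => False
                end)
    (fun B n => match B, n with
                | UnBranch _, _ => True
                | UnBody i B', UnBody j n' => i = j /\ region B' n'
                | _, _ => False
                end).

Fixpoint cfg (S : stmt) : graph :=
  match S with
  | SAssign x E => single_graph (KAssign x E None)
  | SSeq S1 S2 => seq_graph (cfg S1) (cfg S2)
  | SIf E S1 S2 => if_graph E (cfg S1) (cfg S2)
  | SSkip => skip_graph
  | SWhile E S' => while_graph E (cfg S')
  | SSample x E0 f Es => single_graph (KSample x E0 Es None)
  end.

Fixpoint unrolled_cfg (S : stmt) : graph :=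
  match S with
  | SAssign x E => single_graph (KAssign x E None)
  | SSeq S1 S2 => seq_graph (unrolled_cfg S1) (unrolled_cfg S2)
  | SIf E S1 S2 => if_graph E (unrolled_cfg S1) (unrolled_cfg S2)
  | SSkip => skip_graph
  | SWhile E S' => unrolled_while_graph E (unrolled_cfg S')
  | SSample x E0 f Es => single_graph (KSample x E0 Es None)
  end.

Inductive node (G : graph) : Type := START | END | Inner of inner G.
Arguments START {G}.
Arguments END {G}.

Definition target (G : graph) (m : option (inner G)) : node G :=
  if m is Some n then Inner n else END.

Inductive edge (G : graph) : node G -> node G -> Prop :=
| edge_start : edge START (target (first G))
| edge_inner n m :
    List.In m (successors (kind_of n)) -> edge (Inner n) (target m).

(** * Graph semantics *)

Inductive step (G : graph) (tr : trace R) :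
    state * node G -> state * node G -> Prop :=
| step_start s : step tr (s, START) (s, target (first G))
| step_join s n m :
    kind_of n = KJoin m -> step tr (s, Inner n) (s, target m)
| step_assign s n x E m :
    kind_of n = KAssign x E m ->
    step tr (s, Inner n) (upd s x (eval s E), target m)
| step_sample s s' n x E0 (f : dist L) (Es : 'I_(dist_arity f) -> expr) m :
    kind_of n = KSample x E0 Es m -> sample_rule tr s x E0 Es s' ->
    step tr (s, Inner n) (s', target m)
| step_consequent s n E c a :
    kind_of n = KBranch E c a -> eval s E = VBool true ->
    step tr (s, Inner n) (s, target c)
| step_alternative s n E c a :
    kind_of n = KBranch E c a -> eval s E = VBool false ->
    step tr (s, Inner n) (s, target a).

Inductive steps (G : graph) (tr : trace R) :
    state * node G -> state * node G -> Prop :=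
| steps_refl c : steps tr c c
| steps_step c c' c'' : step tr c c' -> steps tr c' c'' -> steps tr c c''.

Definition pG (G : graph) (tr : trace R) : option {nonneg R} :=
  final_density (fun s => steps tr (init_state, @START G) (s, @END G)).

(** * Provenance *)

Section Provenance.
Variable G : graph.
Implicit Types (N M B J : node G) (x y z : Var) (E : expr).

Definition is_sample N : bool :=
  if N is Inner n then if kind_of n is KSample _ _ _ _ _ then true else false
  else false.

(* The variable assigned by an assign or sample node. *)
Definition assigned N : option Var :=
  if N is Inner n then
    match kind_of n with
    | KAssign x _ _ | KSample x _ _ _ _ => Some x
    | _ => None
    end
  else None.

(* [condexp] and [value_expr] are only meaningful at branch nodes and at assign
   nodes, respectively; elsewhere they are a constant. *)
Definition condexp N : expr :=
  if N is Inner n then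
    if kind_of n is KBranch E _ _ then E else Const VNull
  else Const VNull.

(* The expression E' whose variables determine the assigned value: for a sample
   node it is the address expression, without the distribution's arguments. *)
Definition value_expr N : expr :=
  if N is Inner n then
    match kind_of n with
    | KAssign _ E _ => E
    | KSample _ E0 _ _ _ => E0
    | _ => Const VNull
    end
  else Const VNull.

(* {E_0, E_1, ..., E_n} for a sample node. *)
Definition sample_exprs N : set expr :=
  if N is Inner n then
    if kind_of n is KSample _ E0 _ Es _ then E0 |` range Es else set0
  else set0.

Definition addresses N : set address :=
  [set a | is_sample N /\ exists s : state, eval s (value_expr N) = VStr a].

Definition RD N x : set (node G) :=
  [set N' | assigned N' = Some x /\
     exists l : seq (node G), is_path (@edge G) N' (rcons l N) /\
       List.Forall (fun M => assigned M <> Some x) l].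

Definition BranchJoin B J : Prop :=
  match B, J with
  | Inner b, Inner j => branch_join b j
  | _, _ => False
  end.

Definition subgraph B : set (node G) :=
  [set M | match B, M with
           | Inner b, Inner m => region b m
           | _, _ => False
           end].

Definition BP N : set (node G) :=
  [set B | exists J, BranchJoin B J /\
     exists l : seq (node G), [/\ is_path (@edge G) B (rcons l J),
       List.Forall (subgraph B) (B :: rcons l J) &
       List.In N (B :: rcons l J)]].

Inductive prov_pairs N x : node G -> Var -> Prop :=
| prov_start : prov_pairs N x N x
| prov_data M z N' y :
    prov_pairs N x M z -> RD M z N' -> vars (value_expr N') y ->
    prov_pairs N x N' y
| prov_control M z N' B y :
    prov_pairs N x M z -> RD M z N' -> BP N' B -> vars (condexp B) y ->
    prov_pairs N x B y.

Definition prov_var N x : set address :=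
  [set a | exists M z N', [/\ prov_pairs N x M z, RD M z N', is_sample N' &
                              addresses N' a]].

Definition prov N E : set address := \bigcup_(y in vars E) prov_var N y.

End Provenance.

End Language.

Arguments pS {R Var L} S tr.
Arguments cfg {R Var L} S.
Arguments unrolled_cfg {R Var L} S.
Arguments pG {R Var L} G tr.
Arguments KSample {R Var L X} x E0 {f} Es next.
Arguments START {R Var L G}.
Arguments END {R Var L G}.

Section SampleNodes.
Variables (R : realType) (Var : finType) (L : builtins R).

Lemma cfg_finite (S : stmt Var L) :
  exists l : seq (inner (cfg S)), forall n, List.In n l.
Proof.
elim: S => [x E|S1 [l1 H1] S2 [l2 H2]|E S1 [l1 H1] S2 [l2 H2]||E S [l H]|x E0 f Es] /=.
- by exists [:: tt]; case; left.
- exists (map inl l1 ++ map inr l2) => -[n|n]; apply/List.in_or_app; [left|right];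
    exact: List.in_map.
- exists [:: IfBranch, IfJoin & map IfThen l1 ++ map IfElse l2].
  case=> [||n|n]; [by left|by right; left| |]; right; right;
    apply/List.in_or_app; [left|right]; exact: List.in_map.
- by exists [::] => -[].
- exists [:: WhBranch, WhJoin & map WhBody l].
  case=> [||n]; [by left|by right; left|]; right; right; exact: List.in_map.
- by exists [:: tt]; case; left.
Qed.

(* The sample nodes of a control-flow graph can be listed as N_1, ..., N_K. *)
Lemma sample_nodes_enum (S : stmt Var L) :
  exists (K : nat) (N : 'I_K -> node (cfg S)), injective N /\
    forall n, is_sample n <-> exists k, N k = n.
Proof.
have [l Hl] := cfg_finite S.
pose T := {classic node (cfg S)}.
pose s0 : seq T := map (@Inner _ _ _ (cfg S)) l.
pose s : seq T := undup (seq.filter (fun n : T => is_sample (n : node (cfg S))) s0).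
have us : uniq s := undup_uniq _.
have InE (x : T) (r : seq T) : List.In x r <-> x \in r.
  elim: r => //= y r IH; rewrite inE; split.
    by case=> [->|/IH ->]; rewrite ?eqxx ?orbT.
  by case/orP => [/eqP ->|/IH]; [left|right].
have mem (n : T) : (n \in s) = is_sample n.
  rewrite mem_undup mem_filter andb_idr //; case: n => // i _.
  apply/InE; rewrite /s0; apply: List.in_map; exact: Hl.
exists (size s), (fun k => tnth (in_tuple s) k); split.
  move=> i j; rewrite !(tnth_nth (@START _ _ _ (cfg S) : T)) /= => e.
  by apply/val_inj/eqP; rewrite -(nth_uniq (START : T) (ltn_ord i) (ltn_ord j) us); apply/eqP.
move=> n; rewrite -(mem n); split.
  by case/(tnthP (in_tuple s)) => k ->; exists k.
by case=> k <-; apply: (mem_tnth k (in_tuple s)).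
Qed.
End SampleNodes.

(* Main.v *)
(* A terminating execution multiplies the density once per visit of a sample
   node; grouping these contributions by node gives the factors p_k, and both
   graphs simulate the program step by step.  What has to be shown is that the
   factor of N_k only depends on the addresses in A_k, i.e. a noninterference
   property of two terminating runs on traces agreeing on A_k: at corresponding
   points both runs agree on the variables that are live with respect to the
   pairs (M, z) entering the provenances in A_k.  If an if or while statement
   contains an assignment whose value can reach such a pair, or N_k itself, then
   its condition evaluates equally and both runs take the same branch;
   otherwise either run passes through the statement without changing a live
   variable or visiting N_k, even if the two runs take different branches. *)

Require Import Defs.
From mathcomp Require Import all_boot all_order all_algebra interval_inference.
From mathcomp Require Import all_classical reals.

Import Order.TTheory GRing.Theory Num.Theory.
Local Open Scope classical_set_scope.
Local Open Scope ring_scope.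

Section Factorization.
Set Implicit Arguments.
Unset Strict Implicit.
Unset Printing Implicit Defensive.
Variables (R : realType) (Var : finType) (L : builtins R).
Local Notation graph := (graph Var L).
Local Notation stmt := (stmt Var L).
Local Notation expr := (expr Var L).
Local Notation state := (state R Var).
Implicit Types (S : stmt) (E : expr) (s : state) (tr : trace R).

(** * Embedding the graph of a statement into a larger graph *)

Lemma redirect_comp (X Y Z : Type) (h : X -> Y) (h' : Y -> Z) e e' m :
  redirect (h' \o h) (redirect h' e' e) m = redirect h' e' (redirect h e m).
Proof. by case: m. Qed.

Lemma omapE (X Y : Type) (h : X -> Y) : omap h = redirect h None.
Proof. by apply/funext; case. Qed.

Lemma kmap_comp (X Y Z : Type) (h : X -> Y) (h' : Y -> Z) (k : kind Var L X) :
  kmap h' (kmap h k) = kmap (h' \o h) k.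
Proof. by case: k. Qed.

Lemma In_successors_kmap (X Y : Type) (h : X -> Y) (k : kind Var L X) m :
  List.In m (successors k) -> List.In (h m) (successors (kmap h k)).
Proof.
case: k => [E c a|n|x E n|x E f Es n] /= [<-|]; try by [left|case].
by case=> [<-|[]]; right; left.
Qed.

(** [e] is where edges into END of [G] lead inside [G']. Edges out of image nodes are fixed exactly;
    branch-join pairs and regions are only transported forwards, which is enough to produce members
    of [BP]. *)
Record embeds (G G' : graph) (h : inner G -> inner G') (e : option (inner G')) :
    Prop := Embeds {
  embeds_kind n : kind_of (h n) = kmap (redirect h e) (kind_of n);
  embeds_join b j : branch_join b j -> branch_join (h b) (h j);
  embeds_region b n : region b n -> region (h b) (h n)
}.

Lemma embeds_id (G : graph) : embeds (@id (inner G)) None.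
Proof.
split=> // n; rewrite -[LHS]/(id _).
have -> : redirect (@id (inner G)) None = id by apply/funext; case.
by case: (kind_of n).
Qed.

Lemma embeds_comp (G1 G2 G3 : graph) (h : inner G1 -> inner G2) e
    (h' : inner G2 -> inner G3) e' :
  embeds h e -> embeds h' e' -> embeds (h' \o h) (redirect h' e' e).
Proof.
move=> [k j r] [k' j' r']; split=> [n|b c /j/j'|b c /r/r'] //=.
rewrite k' k kmap_comp; congr kmap; apply/funext => m /=.
by rewrite redirect_comp.
Qed.

Lemma embeds_seql (G1 G2 : graph) :
  @embeds G1 (seq_graph G1 G2) inl (omap inr (first G2)).
Proof. by []. Qed.

Lemma embeds_seqr (G1 G2 : graph) : @embeds G2 (seq_graph G1 G2) inr None.
Proof. by split=> // n /=; rewrite omapE. Qed.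

Lemma embeds_then E (G1 G2 : graph) :
  @embeds G1 (if_graph E G1 G2) IfThen (Some IfJoin).
Proof. by []. Qed.

Lemma embeds_else E (G1 G2 : graph) :
  @embeds G2 (if_graph E G1 G2) IfElse (Some IfJoin).
Proof. by []. Qed.

Lemma embeds_body E (G : graph) :
  @embeds G (while_graph E G) WhBody (Some WhBranch).
Proof. by []. Qed.

Lemma embeds_unrolled_body E (G : graph) i :
  @embeds G (unrolled_while_graph E G) (UnBody i) (Some (UnBranch i.+1)).
Proof. by []. Qed.

(** * Walks and membership in [BP] *)

Section Reach.
Variable G : graph.

(* The end point of the walk is not required to satisfy [Q]. *)
Inductive reach (Q : inner G -> Prop) :
    option (inner G) -> option (inner G) -> Prop :=
| reach_refl m : reach Q m m
| reach_step n m m' :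
    Q n -> List.In m (successors (kind_of n)) -> reach Q m m' ->
    reach Q (Some n) m'.

Lemma reach_trans Q m1 m2 m3 : reach Q m1 m2 -> reach Q m2 m3 -> reach Q m1 m3.
Proof. by elim=> // n m m' q i _ IH /IH; apply: reach_step. Qed.

(** The edge from [n] to [m] makes the path nonempty even if [m = m'], so that [l] lists the nodes
    strictly between the end points, the shape used by [RD] and [BP]. *)
Lemma reach_path Q m m' : reach Q m m' ->
  forall n, List.In m (successors (kind_of n)) ->
  exists l, is_path (@edge _ _ _ G) (Inner n) (rcons l (target m')) /\
    List.Forall (fun M => exists2 k, M = Inner k & Q k) l.
Proof.
elim=> {m m'} [m|k m m' q i _ IH] n im.
  by exists [::]; split=> //=; split=> //; apply: edge_inner.
have [l [pl Ql]] := IH _ i; exists (Inner k :: l); split.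
  by split=> //; apply: (edge_inner im).
by constructor=> //; exists k.
Qed.

Lemma reach_inv Q n m' : reach Q (Some n) m' ->
  m' = Some n \/ exists2 m, List.In m (successors (kind_of n)) & reach Q m m'.
Proof.
move e : (Some n) => m p; case: p e => [k|k m1 m2 _ i p] e; first by left.
by case: e => ->; right; exists m1.
Qed.

Lemma is_path_rcons_cat (T : Type) (e : T -> T -> Prop) x l y l' :
  is_path e x (rcons l y) -> is_path e y l' -> is_path e x (rcons l y ++ l').
Proof.
elim: l x => [|z l IH] x /= [xz]; first by move=> _ yl'.
by move=> zl yl'; split=> //; apply: IH.
Qed.

Lemma BP_reach b n j : branch_join b j -> b <> j ->
  region b b -> region b n -> region b j ->
  reach (region b) (Some b) (Some n) -> reach (region b) (Some n) (Some j) ->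
  BP (Inner n) (Inner b).
Proof.
move=> bj neq rb rn rj p1 p2.
have subP l : List.Forall (fun M => exists2 k, M = Inner k & region b k) l ->
    List.Forall (@subgraph _ _ _ G (Inner b)) l.
  by apply: List.Forall_impl => M [k ->].
have Frcons (T : Type) (Q : T -> Prop) l x :
    List.Forall Q l -> Q x -> List.Forall Q (rcons l x).
  move=> Ql Qx; rewrite -cats1; apply/List.Forall_app.
    by split=> //; constructor.
have Inrcons (T : Type) (l : seq T) x : List.In x (rcons l x).
  by rewrite -cats1; apply/List.in_or_app; right; left.
exists (Inner j); split=> //.
(* [reach_path] needs a first edge of each walk, so the cases where a walk is empty, [n = b] and
   [n = j], are separated; [b <> j] excludes both at once. *)
case/reach_inv: p1 => [[nb]|[m im p1]].
  case/reach_inv: p2 => [[jb]|[m im p2]]; first by case: neq; rewrite jb nb.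
  rewrite nb in im *; have [l [pl Ql]] := reach_path p2 im.
  exists l; split=> //; last by left.
  by constructor=> //; apply: Frcons => //; apply: subP.
have [l1 [pl1 Ql1]] := reach_path p1 im.
case/reach_inv: p2 => [[jn]|[m' im' p2]].
  exists l1; split; rewrite ?jn //; last by right; apply: Inrcons.
  by constructor=> //; apply: Frcons => //; apply: subP.
have [l2 [pl2 Ql2]] := reach_path p2 im'.
exists (rcons l1 (Inner n) ++ l2); rewrite rcons_cat; split.
- exact: is_path_rcons_cat.
- constructor=> //; apply/List.Forall_app.
  by split; apply: Frcons => //; apply: subP.
- by right; apply/List.in_or_app; left; apply: Inrcons.
Qed.

End Reach.

Lemma reach_embeds (G G' : graph) (h : inner G -> inner G') e
    (Q : inner G -> Prop) (Q' : inner G' -> Prop) m m' :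
  embeds h e -> (forall n, Q n -> Q' (h n)) -> reach Q m m' ->
  reach Q' (redirect h e m) (redirect h e m').
Proof.
move=> emb QQ'; elim=> {m m'} [m|n m m' /QQ' q i _ IH]; first exact: reach_refl.
apply: (reach_step q _ IH); rewrite (embeds_kind emb).
exact: In_successors_kmap.
Qed.

Local Notation connects m m' := (reach (fun=> True) m m').

Lemma connects_embeds (G G' : graph) (h : inner G -> inner G') e m m' :
  embeds h e -> connects m m' -> connects (redirect h e m) (redirect h e m').
Proof. by move=> emb; apply: reach_embeds. Qed.

Lemma connects_while_join E (G : graph) :
  @reach (while_graph E G) (fun=> True) (Some WhBranch) (Some WhJoin).
Proof.
pose W := while_graph E G.
apply: (@reach_step W _ WhBranch (Some WhJoin)) => //; first by right; left.
exact: reach_refl.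
Qed.

(** Walks of the sub-statements are glued along their embeddings; a loop is left through its
    alternative edge. This later supplies paths to join nodes and to the exit of a statement. *)
Lemma cfg_connected S : connects (first (cfg S)) None /\
  forall n, connects (first (cfg S)) (Some n) /\ connects (Some n) None.
Proof.
elim: S => [x E|S1 [t1 c1] S2 [t2 c2]|E S1 [t1 c1] S2 [t2 c2]||E S [t c]|
  x E0 f Es].
- have st : @reach (cfg (SAssign x E)) (fun=> True) (Some tt) None.
    by apply: (reach_step (m := None)) => //; [left|apply: reach_refl].
  by split=> // -[]; split=> //; apply: reach_refl.
- have e1 := @embeds_seql (cfg S1) (cfg S2).
  have e2 := @embeds_seqr (cfg S1) (cfg S2).
  have p1 := connects_embeds e1 t1.
  have p2 := connects_embeds e2 t2; rewrite -omapE in p2.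
  split; first exact: reach_trans p1 p2.
  case=> [n|n]; split.
  + exact: (connects_embeds e1 (c1 n).1).
  + exact: reach_trans (connects_embeds e1 (c1 n).2) p2.
  + apply: reach_trans p1 _; have := connects_embeds e2 (c2 n).1.
    by rewrite -omapE.
  + exact: (connects_embeds e2 (c2 n).2).
- have e1 := @embeds_then E (cfg S1) (cfg S2).
  have e2 := @embeds_else E (cfg S1) (cfg S2).
  pose G := cfg (SIf E S1 S2).
  have b1 (m : option (inner G)) :
      @reach G (fun=> True)
        (redirect IfThen (Some IfJoin) (first (cfg S1))) m ->
      @reach G (fun=> True) (Some IfBranch) m.
    by apply: reach_step => //; left.
  have b2 (m : option (inner G)) :
      @reach G (fun=> True)
        (redirect IfElse (Some IfJoin) (first (cfg S2))) m ->
      @reach G (fun=> True) (Some IfBranch) m.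
    by apply: reach_step => //; right; left.
  have j : @reach G (fun=> True) (Some IfJoin) None.
    by apply: (reach_step (m := None)) => //; [left|apply: reach_refl].
  have st := b1 _ (connects_embeds e1 t1).
  split; first exact: reach_trans st j.
  case=> [||n|n]; split=> //; try exact: reach_refl.
  + exact: reach_trans st j.
  + exact: b1 (connects_embeds e1 (c1 n).1).
  + exact: reach_trans (connects_embeds e1 (c1 n).2) j.
  + exact: b2 (connects_embeds e2 (c2 n).1).
  + exact: reach_trans (connects_embeds e2 (c2 n).2) j.
- by split=> [|[]]; apply: reach_refl.
- have e1 := @embeds_body E (cfg S).
  pose G := cfg (SWhile E S).
  have b (m : option (inner G)) :
      @reach G (fun=> True)
        (redirect WhBody (Some WhBranch) (first (cfg S))) m ->
      @reach G (fun=> True) (Some WhBranch) m.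
    by apply: reach_step => //; left.
  have bj := connects_while_join E (cfg S).
  have j : @reach G (fun=> True) (Some WhJoin) None.
    by apply: (reach_step (m := None)) => //; [left|apply: reach_refl].
  split; first exact: reach_trans bj j.
  case=> [||n]; split=> //; try exact: reach_refl.
  + exact: reach_trans bj j.
  + exact: b (connects_embeds e1 (c n).1).
  + apply: reach_trans (connects_embeds e1 (c n).2) _.
    exact: reach_trans bj j.
- have st : @reach (cfg (SSample x E0 Es)) (fun=> True) (Some tt) None.
    by apply: (reach_step (m := None)) => //; [left|apply: reach_refl].
  by split=> // -[]; split=> //; apply: reach_refl.
Qed.

Lemma BP_embeds (G G' : graph) (h : inner G -> inner G') e b n j E c a m :
  embeds h e -> kind_of b = KBranch E c a -> kind_of j = KJoin _ _ m ->
  branch_join b j -> (forall k, region b k) ->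
  connects (Some b) (Some n) -> connects (Some n) (Some j) ->
  BP (Inner (h n)) (Inner (h b)).
Proof.
move=> emb kb kj bj reg p1 p2.
have reg' k : region (h b) (h k) by apply: (embeds_region emb).
apply: (BP_reach (embeds_join emb bj)) => //.
(* A common image of [b] and [j] would be both a branch node and a join node. *)
- move=> eq; have := embeds_kind emb b.
  by rewrite eq (embeds_kind emb) kb kj.
- by apply: (reach_embeds emb _ p1) => k _.
- by apply: (reach_embeds emb _ p2) => k _.
Qed.

(** Each arm runs into the join node, so every node of the statement lies on a path from branch to
    join. One relevant node thus suffices to bring the condition into the provenance. *)
Lemma BP_if E S1 S2 (G : graph) (h : inner (cfg (SIf E S1 S2)) -> inner G) e n :
  embeds h e -> BP (Inner (h n)) (Inner (h IfBranch)).
Proof.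
move=> emb; have [t1 c1] := cfg_connected S1; have [t2 c2] := cfg_connected S2.
have e1 := @embeds_then E (cfg S1) (cfg S2).
have e2 := @embeds_else E (cfg S1) (cfg S2).
have [_ /(_ n) [p _]] := cfg_connected (SIf E S1 S2).
pose G0 := cfg (SIf E S1 S2).
apply: (BP_embeds emb (b := (IfBranch : inner G0))
  (j := (IfJoin : inner G0)) erefl erefl) => //=.
case: n {p} => [||n|n].
- apply: (reach_step _ _ (connects_embeds e1 t1)) => //; by left.
- exact: reach_refl.
- exact: (connects_embeds e1 (c1 n).2).
- exact: (connects_embeds e2 (c2 n).2).
Qed.

(** From the body the path first returns to the branch node and only then leaves for the join
    node. *)
Lemma BP_while E S (G : graph) (h : inner (cfg (SWhile E S)) -> inner G) e n :
  embeds h e -> BP (Inner (h n)) (Inner (h WhBranch)).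
Proof.
move=> emb; have [t c] := cfg_connected S.
have e1 := @embeds_body E (cfg S).
have [_ /(_ n) [p _]] := cfg_connected (SWhile E S).
pose G0 := cfg (SWhile E S).
apply: (BP_embeds emb (b := (WhBranch : inner G0))
  (j := (WhJoin : inner G0)) erefl erefl) => //=.
have bj := connects_while_join E (cfg S).
case: n {p} => [||n] //; first exact: reach_refl.
exact: reach_trans (connects_embeds e1 (c n).2) bj.
Qed.

(** * Embeddings of the sub-statements of an embedded statement *)

Section DerivedEmbeddings.
Variables (E : expr) (G1 G2 G : graph) (e : option (inner G)).

Section Seq.
Variable h : inner (seq_graph G1 G2) -> inner G.

Lemma redirect_first_seq : redirect h e (first (seq_graph G1 G2)) =
  redirect (fun n => h (inl n)) (redirect (fun n => h (inr n)) e (first G2))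
    (first G1).
Proof. by rewrite /=; case: (first G1) => //; case: (first G2). Qed.

Lemma embeds_seq : embeds h e ->
  embeds (fun n => h (inl n)) (redirect (fun n => h (inr n)) e (first G2)) /\
  embeds (fun n => h (inr n)) e.
Proof.
move=> emb; split; last exact: embeds_comp (@embeds_seqr G1 G2) emb.
have -> : redirect (fun n => h (inr n)) e (first G2) =
    redirect h e (omap inr (first G2)) by case: (first G2).
exact: embeds_comp (@embeds_seql G1 G2) emb.
Qed.
End Seq.

Section If.
Variable h : inner (if_graph E G1 G2) -> inner G.

Lemma embeds_if : embeds h e ->
  embeds (fun n => h (IfThen n)) (Some (h IfJoin)) /\
  embeds (fun n => h (IfElse n)) (Some (h IfJoin)).
Proof.
move=> emb; split.
- exact: embeds_comp (@embeds_then E G1 G2) emb.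
- exact: embeds_comp (@embeds_else E G1 G2) emb.
Qed.

Lemma kind_if_branch : embeds h e -> kind_of (h IfBranch) =
  KBranch E (redirect (fun n => h (IfThen n)) (Some (h IfJoin)) (first G1))
    (redirect (fun n => h (IfElse n)) (Some (h IfJoin)) (first G2)).
Proof.
by move/embeds_kind/(_ IfBranch) => -> /=; rewrite -!redirect_comp.
Qed.
End If.

Section While.
Variable h : inner (while_graph E G1) -> inner G.

Lemma embeds_while : embeds h e ->
  embeds (fun n => h (WhBody n)) (Some (h WhBranch)).
Proof. by move=> emb; apply: embeds_comp (@embeds_body E G1) emb. Qed.

Lemma kind_while_branch : embeds h e -> kind_of (h WhBranch) =
  KBranch E (redirect (fun n => h (WhBody n)) (Some (h WhBranch)) (first G1))
    (Some (h WhJoin)).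
Proof.
by move/embeds_kind/(_ WhBranch) => -> /=; rewrite -!redirect_comp.
Qed.
End While.

Section Unrolled.
Variable h : inner (unrolled_while_graph E G1) -> inner G.

Lemma embeds_unrolled i : embeds h e ->
  embeds (fun n => h (UnBody i n)) (Some (h (UnBranch i.+1))).
Proof.
by move=> emb; apply: embeds_comp (@embeds_unrolled_body E G1 i) emb.
Qed.

Lemma kind_unrolled_branch i : embeds h e -> kind_of (h (UnBranch i)) =
  KBranch E
    (redirect (fun n => h (UnBody i n)) (Some (h (UnBranch i.+1))) (first G1))
    (Some (h UnJoin)).
Proof.
by move/embeds_kind/(_ (UnBranch i)) => -> /=; rewrite -!redirect_comp.
Qed.
End Unrolled.
End DerivedEmbeddings.

(** * Executions with a log of sampling events *)

Section Runs.
Variable I : Type.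
Local Notation log := (seq (I * {nonneg R})).

(** Iteration is inductive over an abstract [body], since the semantics of a loop refers to the loop
    again and so is not structurally recursive in the statement. *)
Inductive loop (body : state -> log -> state -> Prop) E :
    state -> log -> state -> Prop :=
| loop_done s : eval s E = VBool false -> loop body E s [::] s
| loop_next s l1 s1 l2 s2 :
    eval s E = VBool true -> body s l1 s1 -> loop body E s1 l2 s2 ->
    loop body E s (l1 ++ l2) s2.

(* The program semantics, logging each sampling event as the image under [h] of
   the sample node together with the factor it contributes to the density. *)
Fixpoint run tr S :
    (inner (cfg S) -> I) -> state -> log -> state -> Prop :=
  match S with
  | SAssign x E => fun _ s l s' => l = [::] /\ s' = upd s x (eval s E)
  | SSeq S1 S2 => fun h s l s' => exists l1 s1 l2,
      [/\ run tr (fun n => h (inl n)) s l1 s1,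
          run tr (fun n => h (inr n)) s1 l2 s' & l = l1 ++ l2]
  | SIf E S1 S2 => fun h s l s' =>
      (eval s E = VBool true /\ run tr (fun n => h (IfThen n)) s l s') \/
      (eval s E = VBool false /\ run tr (fun n => h (IfElse n)) s l s')
  | SSkip => fun _ s l s' => l = [::] /\ s' = s
  | SWhile E S0 => fun h => loop (run tr (fun n => h (WhBody n))) E
  | SSample x E0 f Es => fun h s l s' => exists a,
      let v := pdf (tr a) (fun i => eval s (Es i)) in
      [/\ eval s E0 = VStr a, forall i, eval s (Es i) <> VNull, tr a <> VNull,
          l = [:: (h tt, v)] & s' = scale (upd s x (tr a)) v]
  end.

Lemma exec_run tr s S s' : exec tr s S s' ->
  forall h : inner (cfg S) -> I, exists l, run tr h s l s'.
Proof.
elim=> {s S s'}.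
- by move=> s h; exists [::].
- by move=> s x E h; exists [::].
- move=> s s1 s2 S1 S2 _ IH1 _ IH2 h.
  have [l1 r1] := IH1 (fun n => h (inl n)).
  have [l2 r2] := IH2 (fun n => h (inr n)).
  by exists (l1 ++ l2), l1, s1, l2.
- move=> s s' E S1 S2 Et _ IH h.
  by have [l r] := IH (fun n => h (IfThen n)); exists l; left.
- move=> s s' E S1 S2 Et _ IH h.
  by have [l r] := IH (fun n => h (IfElse n)); exists l; right.
- by move=> s E S Ef h; exists [::]; apply: loop_done.
- move=> s s' E S Et _ IH h.
  (* The rule executes the body followed by the loop, whose graph contains the body twice; this
     labelling sends both copies to the nodes of the single body. *)
  have [l [l1 [s1 [l2 [r1 r2 _]]]]] :=
    IH (fun n => match n with inl n' => h (WhBody n') | inr n' => h n' end).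
  by exists (l1 ++ l2); apply: loop_next r1 r2.
- move=> s s' x E0 f Es [a [ea ne nt ->]] h.
  by eexists; exists a.
Qed.

Definition weight (i : I) (l : log) : {nonneg R} :=
  foldr (fun ev w => if `[< ev.1 = i >] then (ev.2%:num * w%:num)%:nng else w)
    1%:nng l.

Lemma weight_cat i l1 l2 :
  (weight i (l1 ++ l2))%:num = (weight i l1)%:num * (weight i l2)%:num.
Proof.
elim: l1 => [|ev l1 IH] /=; first by rewrite mul1r.
by case: ifP => _ //=; rewrite IH mulrA.
Qed.

End Runs.
Arguments exec_run {I tr s S s'} _ h.

(** * Both graphs simulate the program *)

Section Simulation.
Variable tr : trace R.

Lemma steps_trans (G : graph) (c1 c2 c3 : state * node G) :
  steps tr c1 c2 -> steps tr c2 c3 -> steps tr c1 c3.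
Proof. by elim=> // c c' c'' st _ IH /IH; apply: steps_step. Qed.

Lemma steps1 (G : graph) (c1 c2 : state * node G) :
  step tr c1 c2 -> steps tr c1 c2.
Proof. by move=> st; apply: steps_step st (steps_refl _ _). Qed.

(** Quantifying over all embeddings of [G0] makes the property compositional; [G0] is arbitrary so
    that one set of lemmas serves [cfg] and [unrolled_cfg]. *)
Definition simulates (G0 : graph) (P : state -> state -> Prop) :=
  forall (G : graph) (h : inner G0 -> inner G) e, embeds h e ->
  forall s s', P s s' ->
  steps tr (s, target (redirect h e (first G0))) (s', target e).

Lemma simulates_seq (G1 G2 : graph) P1 P2 :
  simulates G1 P1 -> simulates G2 P2 ->
  simulates (seq_graph G1 G2) (fun s s' => exists2 s1, P1 s s1 & P2 s1 s').
Proof.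
move=> H1 H2 G h e emb s s' [s1 p1 p2]; rewrite redirect_first_seq.
have [emb1 emb2] := embeds_seq emb.
exact: steps_trans (H1 _ _ _ emb1 _ _ p1) (H2 _ _ _ emb2 _ _ p2).
Qed.

Lemma simulates_if E (G1 G2 : graph) P1 P2 :
  simulates G1 P1 -> simulates G2 P2 ->
  simulates (if_graph E G1 G2) (fun s s' =>
    (eval s E = VBool true /\ P1 s s') \/ (eval s E = VBool false /\ P2 s s')).
Proof.
move=> H1 H2 G h e emb s s' p.
have [emb1 emb2] := embeds_if emb; have kb := kind_if_branch emb.
have kj : kind_of (h IfJoin) = KJoin _ _ e by rewrite (embeds_kind emb).
case: p => [[Et p]|[Ef p]].
- apply: steps_step (step_consequent tr kb Et) _.
  apply: steps_trans (H1 _ _ _ emb1 _ _ p) _.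
  exact/steps1/step_join.
- apply: steps_step (step_alternative tr kb Ef) _.
  apply: steps_trans (H2 _ _ _ emb2 _ _ p) _.
  exact/steps1/step_join.
Qed.

Lemma simulates_while I (body : state -> seq (I * {nonneg R}) -> state -> Prop)
    E (G0 : graph) :
  simulates G0 (fun s s' => exists l, body s l s') ->
  simulates (while_graph E G0) (fun s s' => exists l, loop body E s l s').
Proof.
move=> H G h e emb s s' [l p].
have emb1 := embeds_while emb; have kb := kind_while_branch emb.
have kj : kind_of (h WhJoin) = KJoin _ _ e by rewrite (embeds_kind emb).
rewrite /=; elim: p => {s l s'} [s Ef|s l1 s1 l2 s2 Et p _ IH].
- apply: steps_step (step_alternative tr kb Ef) _.
  exact/steps1/step_join.
- apply: steps_step (step_consequent tr kb Et) _.
  apply: steps_trans IH; apply: H emb1 _ _ _; by exists l1.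
Qed.

Lemma simulates_unrolled I
    (body : state -> seq (I * {nonneg R}) -> state -> Prop) E (G0 : graph) :
  simulates G0 (fun s s' => exists l, body s l s') ->
  simulates (unrolled_while_graph E G0)
    (fun s s' => exists l, loop body E s l s').
Proof.
move=> H G h e emb s s' [l p]; rewrite /=.
have kj : kind_of (h UnJoin) = KJoin _ _ e by rewrite (embeds_kind emb).
(* The starting copy is generalised from 0 to [i], as the remaining iterations start at copy
   [i.+1]. *)
elim: p 0%N => {s l s'} [s Ef|s l1 s1 l2 s2 Et p _ IH] i.
- apply: steps_step (step_alternative tr (kind_unrolled_branch i emb) Ef) _.
  exact/steps1/step_join.
- apply: steps_step (step_consequent tr (kind_unrolled_branch i emb) Et) _.
  apply: steps_trans (IH i.+1); apply: H (embeds_unrolled i emb) _ _ _.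
  by exists l1.
Qed.

Lemma simulates_assign I x E (h : inner (cfg (SAssign x E)) -> I) :
  simulates (cfg (SAssign x E)) (fun s s' => exists l, run tr h s l s').
Proof.
move=> G h' e emb s s' [l [_ ->]]; apply/steps1/step_assign.
by rewrite (embeds_kind emb).
Qed.

Lemma simulates_sample I x E0 (f : dist L) (Es : 'I_(dist_arity f) -> expr)
    (h : inner (cfg (SSample x E0 Es)) -> I) :
  simulates (cfg (SSample x E0 Es)) (fun s s' => exists l, run tr h s l s').
Proof.
move=> G h' e emb s s' [l [a [ea ne nt _ ->]]]; apply/steps1.
by apply: step_sample; [rewrite (embeds_kind emb)|exists a].
Qed.

Lemma simulates_skip I (h : inner (cfg (@SSkip _ Var L)) -> I) :
  simulates (cfg (@SSkip _ Var L)) (fun s s' => exists l, run tr h s l s').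
Proof. by move=> G h' e _ s s' [l [_ ->]]; apply: steps_refl. Qed.

Lemma simulatesW (G : graph) (P Q : state -> state -> Prop) :
  (forall s s', Q s s' -> P s s') -> simulates G P -> simulates G Q.
Proof. by move=> QP H G' h e emb s s' /QP; apply: H. Qed.

(** Only the states of a run matter here, so logs labelled by nodes of [cfg S] serve for the
    unrolled graph as well. *)
Lemma run_simulates I S (h : inner (cfg S) -> I) :
  simulates (cfg S) (fun s s' => exists l, run tr h s l s') /\
  simulates (unrolled_cfg S) (fun s s' => exists l, run tr h s l s').
Proof.
elim: S h => [x E|S1 IH1 S2 IH2|E S1 IH1 S2 IH2||E S IH|x E0 f Es] h.
- by split; apply: simulates_assign.
- have [H1 U1] := IH1 (fun n => h (inl n)).
  have [H2 U2] := IH2 (fun n => h (inr n)).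
  have sub s s' : (exists l, run tr h s l s') -> exists2 s1,
      exists l, run tr (fun n => h (inl n)) s l s1 &
      exists l, run tr (fun n => h (inr n)) s1 l s'.
    by move=> [l [l1 [s1 [l2 [r1 r2 _]]]]]; exists s1; [exists l1|exists l2].
  by split; apply: simulatesW sub _; apply: simulates_seq.
- have [H1 U1] := IH1 (fun n => h (IfThen n)).
  have [H2 U2] := IH2 (fun n => h (IfElse n)).
  have sub s s' : (exists l, run tr h s l s') ->
      (eval s E = VBool true /\
       exists l, run tr (fun n => h (IfThen n)) s l s')
      \/
      (eval s E = VBool false /\
       exists l, run tr (fun n => h (IfElse n)) s l s').
    by move=> [l [[Et r]|[Ef r]]]; [left|right]; split=> //; exists l.
  by split; apply: simulatesW sub _; apply: simulates_if.
- by split; apply: simulates_skip.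
- have [H U] := IH (fun n => h (WhBody n)).
  by split; [apply: simulates_while|apply: simulates_unrolled].
- by split; apply: simulates_sample.
Qed.

(** * Determinism and the densities of final states *)

Definition step_kind (G : graph) s (k : kind Var L (option (inner G)))
    (c : state * node G) : Prop :=
  match k with
  | KBranch E m m' => (eval s E = VBool true /\ c = (s, target m)) \/
                      (eval s E = VBool false /\ c = (s, target m'))
  | KJoin m => c = (s, target m)
  | KAssign x E m => c = (upd s x (eval s E), target m)
  | KSample x E0 f Es m => exists2 s', sample_rule tr s x E0 Es s' &
                                       c = (s', target m)
  end.

(** Reading a step off [kind_of n] lets two steps from one node be compared over the same [f] and
    [Es], without inverting dependent constructors. *)
Lemma step_inv (G : graph) s (N : node G) c : step tr (s, N) c ->
  match N with
  | START => c = (s, target (first G))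
  | END => False
  | Inner n => step_kind s (kind_of n) c
  end.
Proof.
move e : (s, N) => d st; case: st e => [s1|s1 n m k|s1 n x E m k|
  s1 s2 n x E0 f Es m k r|s1 n E m m' k Et|s1 n E m m' k Ef] [-> ->] //;
  rewrite k //=.
- by exists s2.
- by left.
- by right.
Qed.

Lemma step_det (G : graph) (c c1 c2 : state * node G) :
  step tr c c1 -> step tr c c2 -> c1 = c2.
Proof.
case: c => s [||n] /step_inv H1 /step_inv H2 //; first by rewrite H1 H2.
case: (kind_of n) H1 H2 => [E m m'|m|x E m|x E0 f Es m] /=.
- by move=> [[e1 ->]|[e1 ->]] [[e2 ->]|[e2 ->]] //; rewrite e1 in e2.
- by move=> -> ->.
- by move=> -> ->.
- move=> [s1 [a [ea _ _ ->]] ->] [s2 [b [eb _ _ ->]] ->].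
  by move: eb; rewrite ea => -[->].
Qed.

Lemma steps_inv (G : graph) (c c' : state * node G) : steps tr c c' ->
  c = c' \/ exists2 c1, step tr c c1 & steps tr c1 c'.
Proof. by case=> [d|d d1 d' st p]; [left|right; exists d1]. Qed.

Lemma steps_det (G : graph) (c : state * node G) s1 s2 :
  steps tr c (s1, END) -> steps tr c (s2, END) -> s1 = s2.
Proof.
move e : (s1, END) => c1 p; elim: p e => {c c1} [_ <-|c c' c1 st _ IH e].
  by case/steps_inv => [[]|[c1 /step_inv]].
case/steps_inv => [ec|[c2 st' p]]; first by rewrite ec in st; case/step_inv: st.
by apply: IH e _; rewrite (step_det st st').
Qed.

Lemma final_densityE (P : state -> Prop) s :
  P s -> (forall s', P s' -> s' = s) -> final_density P = Some (density s).
Proof.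
move=> Ps uniq; rewrite /final_density.
case: pselect => [ex|[]]; last by exists s.
by rewrite (uniq _ (projT2 (cid ex))).
Qed.

Lemma simulates_steps (G : graph) P s s' : simulates G P -> P s s' ->
  steps tr (s, @START _ _ _ G) (s', END).
Proof.
move=> sim Ps; apply: steps_step (step_start _ _ _) _.
by have := sim _ _ _ (embeds_id G) _ _ Ps; case: (first G).
Qed.

Lemma simulates_pG (G : graph) P s :
  simulates G P -> P (init_state R Var) s -> pG G tr = Some (density s).
Proof.
move=> sim /(simulates_steps sim) p.
by apply: (final_densityE p) => s' p'; apply: steps_det p' p.
Qed.

(** Determinism is inherited from the graph, where both executions become transition sequences from
    START to END. *)
Lemma exec_det S s s1 s2 : exec tr s S s1 -> exec tr s S s2 -> s1 = s2.
Proof.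
have [sim _] := run_simulates (@Inner _ _ _ (cfg S)) => ex1 ex2.
have p1 := simulates_steps sim (exec_run ex1 _).
have p2 := simulates_steps sim (exec_run ex2 _).
exact: steps_det p1 p2.
Qed.

End Simulation.

(** * The density as a product over the sample nodes *)

Lemma run_density tr K (G : graph) (N : 'I_K -> node G) :
  injective N -> (forall n, is_sample n -> exists k, N k = n) ->
  forall S (h : inner (cfg S) -> inner G) e s l s', embeds h e ->
  run tr (fun n => Inner (h n)) s l s' ->
  (density s')%:num = (density s)%:num * \prod_(k < K) (weight (N k) l)%:num.
Proof.
move=> inj all.
have nil : \prod_(k < K) (weight (N k) [::])%:num = 1 :> R by rewrite big1.
have cat l1 l2 : \prod_(k < K) (weight (N k) (l1 ++ l2))%:num =
    (\prod_(k < K) (weight (N k) l1)%:num) *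
    \prod_(k < K) (weight (N k) l2)%:num :> R.
  by rewrite -big_split; apply: eq_bigr => k _; rewrite weight_cat.
elim=> [x E|S1 IH1 S2 IH2|E S1 IH1 S2 IH2||E S IH|x E0 f Es] h e s l s' emb.
- by move=> [-> ->]; rewrite nil mulr1.
- have [emb1 emb2] := embeds_seq emb.
  move=> [l1 [s1 [l2 [/(IH1 _ _ _ _ _ emb1) e1 /(IH2 _ _ _ _ _ emb2) -> ->]]]].
  by rewrite e1 cat mulrA.
- have [emb1 emb2] := embeds_if emb.
  by move=> [[_ /(IH1 _ _ _ _ _ emb1)]|[_ /(IH2 _ _ _ _ _ emb2)]].
- by move=> [-> ->]; rewrite nil mulr1.
- have emb1 := embeds_while emb => /=.
  elim=> {s l s'} [s _|s l1 s1 l2 s2 _ /(IH _ _ _ _ _ emb1) e1 _ ->].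
    by rewrite nil mulr1.
  by rewrite e1 cat mulrA.
- have [k Nk] : exists k, N k = Inner (h tt).
    by apply: all; rewrite /is_sample (embeds_kind emb).
  move=> [a /= [_ _ _ -> ->]] /=; congr (_ * _).
  (* The event is counted at [k], and by injectivity of [N] at no other index. *)
  rewrite (bigD1 k) //= big1 ?mulr1 => [|j /negP neq].
    by rewrite (asboolT (esym Nk)) /= !mulr1.
  by rewrite /= asboolF // => eq; apply: neq; apply/eqP/inj; rewrite Nk.
Qed.

(** * Noninterference with respect to one sample node *)

Section Noninterference.
Variables (G : graph) (n0 : inner G) (A : set address).
Variable P : node G -> Var -> Prop.

(* [P M z]: the value of [z] on entering [M] may influence the factors
   contributed by [n0]. *)
Hypothesis P_data : forall M z N y,
  P M z -> RD M z N -> vars (value_expr N) y -> P N y.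
Hypothesis P_control : forall M z N B y,
  P M z -> RD M z N -> BP N B -> vars (condexp B) y -> P B y.
Hypothesis P_addresses : forall M z N,
  P M z -> RD M z N -> is_sample N -> addresses N `<=` A.
Hypothesis P_sample : forall E y,
  sample_exprs (Inner n0) E -> vars E y -> P (Inner n0) y.
Hypothesis P_sample_control : forall B y,
  BP (Inner n0) B -> vars (condexp B) y -> P B y.
Hypothesis sample_addresses : addresses (Inner n0) `<=` A.

(* [z] holds at [m] the value it has at some [m'] with [P m' z]: the backward
   closure that [P], which only contains the points of use, lacks. *)
Definition live (m : option (inner G)) (z : Var) := exists2 m',
  reach (fun n => assigned (Inner n) <> Some z) m m' & P (target m') z.

(** These are the nodes through which [P_sample_control] and [P_control] bring branch conditions
    into [P]. *)
Definition relevant (n : inner G) :=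
  n = n0 \/ exists M z, P M z /\ RD M z (Inner n).

Definition agree m s1 s2 := forall z, live m z -> store s1 z = store s2 z.

Lemma live_P n z : P (Inner n) z -> live (Some n) z.
Proof. by exists (Some n) => //; apply: reach_refl. Qed.

Lemma live_step n m z : List.In m (successors (kind_of n)) ->
  assigned (Inner n) <> Some z -> live m z -> live (Some n) z.
Proof. by move=> im az [m' p Pz]; exists m' => //; apply: reach_step p. Qed.

(** The walk witnessing liveness does not reassign [z], so preceded by [n] it is a path witnessing a
    reaching definition. *)
Lemma live_RD n m z : List.In m (successors (kind_of n)) ->
  assigned (Inner n) = Some z -> live m z ->
  exists2 M, P M z & RD M z (Inner n).
Proof.
move=> im az [m' p Pz]; exists (target m') => //; split=> //.
have [l [pl Ql]] := reach_path p im; exists l; split=> //.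
by apply: List.Forall_impl Ql => M [k ->].
Qed.

Lemma relevant_control n B y :
  relevant n -> BP (Inner n) B -> vars (condexp B) y -> P B y.
Proof.
move=> [->|[M [z [PM rd]]]]; first exact: P_sample_control.
exact: P_control PM rd.
Qed.

Lemma agree_step n m s1 s2 : List.In m (successors (kind_of n)) ->
  assigned (Inner n) = None -> agree (Some n) s1 s2 -> agree m s1 s2.
Proof. by move=> im an ag z lz; apply/ag/(live_step im) => //; rewrite an. Qed.

Lemma eval_eq s1 s2 E :
  (forall y, vars E y -> store s1 y = store s2 y) -> eval s1 E = eval s2 E.
Proof.
elim: E => [c|x|g Es IH] //= eq; first exact: eq.
by congr fn_sem; apply/funext => i; apply: IH => y yi; apply: eq; exists i.
Qed.

Lemma eval_agree n s1 s2 E : agree (Some n) s1 s2 ->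
  (forall y, vars E y -> P (Inner n) y) -> eval s1 E = eval s2 E.
Proof. by move=> ag PE; apply: eval_eq => y /PE/live_P/ag. Qed.

Section Irrelevant.
Variables (S : stmt) (h : inner (cfg S) -> inner G) (e : option (inner G)).
Hypothesis emb : embeds h e.
Hypothesis irr : forall n, ~ relevant (h n).

(* An assignment to a live variable would be relevant. *)
Lemma live_irrelevant z m : live e z -> live (redirect h e m) z.
Proof.
move=> le; case: m => [n|]; last exact: le.
(* Liveness is propagated backwards from the exit along a walk from [n] to it. *)
have [_] := (cfg_connected S).2 n.
move: (Some n) => m0; move E : None => m1 p.
elim: p E => {m0 m1} [_ <-|k m1 m2 _ i _ IH Em]; first exact: le.
have i' : List.In (redirect h e m1) (successors (kind_of (h k))).
  by rewrite (embeds_kind emb); apply: In_successors_kmap.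
apply: (live_step i') (IH Em) => az.
have [M PM rd] := live_RD i' az (IH Em).
by apply: (irr (n := k)); right; exists M, z.
Qed.

Lemma irrelevant_assigned n m z : List.In m (successors (kind_of n)) ->
  live e z -> assigned (Inner (h n)) <> Some z.
Proof.
move=> i le az.
have i' : List.In (redirect h e m) (successors (kind_of (h n))).
  by rewrite (embeds_kind emb); apply: In_successors_kmap.
have [M PM rd] := live_RD i' az (live_irrelevant m le).
by apply: (irr (n := n)); right; exists M, z.
Qed.
End Irrelevant.

(** A variable live at the exit is live throughout the statement, so any assignment to it would be
    relevant. The branches taken and the number of iterations are arbitrary, which is what lets two
    runs diverge here. *)
Lemma run_irrelevant tr S (h : inner (cfg S) -> inner G) e s l s' :
  embeds h e -> (forall n, ~ relevant (h n)) ->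
  run tr (fun n => Inner (h n)) s l s' ->
  weight (Inner n0) l = 1%:nng /\ forall z, live e z -> store s' z = store s z.
Proof.
have cat (l1 l2 : seq (node G * {nonneg R})) :
    weight (Inner n0) l1 = 1%:nng -> weight (Inner n0) l2 = 1%:nng ->
    weight (Inner n0) (l1 ++ l2) = 1%:nng.
  by move=> e1 e2; apply: val_inj; rewrite /= weight_cat e1 e2 mulr1.
elim: S h e s l s' => [x E|S1 IH1 S2 IH2|E S1 IH1 S2 IH2||E S IH|x E0 f Es]
  h e s l s' emb irr.
- move=> [-> ->]; split=> // z lz /=; case: eqP => // zx.
  have [] := @irrelevant_assigned _ _ _ emb irr tt None z _ lz; first by left.
  by rewrite /= (embeds_kind emb) zx.
- move=> [l1 [s1 [l2 [r1 r2 ->]]]]; have [emb1 emb2] := embeds_seq emb.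
  have [w1 e1] := IH1 _ _ _ _ _ emb1 (fun n => irr (inl n)) r1.
  have [w2 e2] := IH2 _ _ _ _ _ emb2 (fun n => irr (inr n)) r2.
  split=> [|z lz]; first exact: cat.
  rewrite e2 // e1 //; apply: live_irrelevant emb2 _ _ _ lz => n.
  exact: (irr (inr n)).
- have [emb1 emb2] := embeds_if emb.
  have lJ z : live e z -> live (Some (h IfJoin)) z.
    exact: (live_irrelevant emb irr (Some IfJoin)).
  case=> [[_ r]|[_ r]].
  + have [w1 e1] := IH1 _ _ _ _ _ emb1 (fun n => irr (IfThen n)) r.
    by split=> // z /lJ /e1.
  + have [w1 e1] := IH2 _ _ _ _ _ emb2 (fun n => irr (IfElse n)) r.
    by split=> // z /lJ /e1.
- by move=> [-> ->].
- have emb1 := embeds_while emb.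
  have lB z : live e z -> live (Some (h WhBranch)) z.
    exact: (live_irrelevant emb irr (Some WhBranch)).
  rewrite /=; elim=> {s l s'} [s _|s l1 s1 l2 s2 _ r1 _ [w2 e2]] //.
  have [w1 e1] := IH _ _ _ _ _ emb1 (fun n => irr (WhBody n)) r1.
  by split=> [|z lz]; [exact: cat|rewrite e2 // e1 //; exact: lB].
- move=> [a /= [_ _ _ -> ->]]; split=> [|z lz /=].
    by rewrite /= asboolF // => -[eq]; apply: (irr tt); left.
  case: eqP => // zx.
  have [] := @irrelevant_assigned _ _ _ emb irr tt None z _ lz; first by left.
  by rewrite /= (embeds_kind emb) zx.
Qed.

Section TwoRuns.
Variables tr1 tr2 : trace R.
Hypothesis tr_eq : forall a, A a -> tr1 a = tr2 a.

Definition agree_runs S (h : inner (cfg S) -> inner G) e :=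
  forall s1 s2 l1 l2 s1' s2',
  run tr1 (fun n => Inner (h n)) s1 l1 s1' ->
  run tr2 (fun n => Inner (h n)) s2 l2 s2' ->
  agree (redirect h e (first (cfg S))) s1 s2 ->
  agree e s1' s2' /\ weight (Inner n0) l1 = weight (Inner n0) l2.

(** Each run is compared with its own initial state, never directly with the other run. *)
Lemma agree_runs_irrelevant S (h : inner (cfg S) -> inner G) e :
  embeds h e -> ~ (exists n, relevant (h n)) -> agree_runs h e.
Proof.
move=> emb nrel s1 s2 l1 l2 s1' s2' r1 r2 ag.
have irr n : ~ relevant (h n) by move=> rel; apply: nrel; exists n.
have [w1 e1] := run_irrelevant emb irr r1.
have [w2 e2] := run_irrelevant emb irr r2.
split; last by rewrite w1 w2.
by move=> z lz; rewrite e1 // e2 //; apply/ag/live_irrelevant.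
Qed.

Lemma run_agree S (h : inner (cfg S) -> inner G) e :
  embeds h e -> agree_runs h e.
Proof.
have cat (l1 l2 l1' l2' : seq (node G * {nonneg R})) :
    weight (Inner n0) l1 = weight (Inner n0) l1' ->
    weight (Inner n0) l2 = weight (Inner n0) l2' ->
    weight (Inner n0) (l1 ++ l2) = weight (Inner n0) (l1' ++ l2').
  by move=> e1 e2; apply: val_inj; rewrite /= !weight_cat e1 e2.
elim: S h e => [x E|S1 IH1 S2 IH2|E S1 IH1 S2 IH2||E S IH|x E0 f Es] h e emb.
- move=> s1 s2 l1 l2 s1' s2' [-> ->] [-> ->] /= ag; split=> // z lz /=.
  have kn := embeds_kind emb tt; rewrite /= in kn.
  have ie : List.In e (successors (kind_of (h tt))) by rewrite kn; left.
  (* If [z] is not [x], it is already live before the assignment; if it is [x], this node is a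
     reaching definition and [P_data] makes the variables of [E] agree. *)
  have [zx|zx] := eqVneq z x; last first.
    by apply/ag/(live_step ie) => //=; rewrite kn => -[/esym/eqP]; apply/negP.
  have [|M PM rd] := live_RD ie _ lz; first by rewrite /= kn zx.
  apply: (eval_agree ag) => y yE; apply: P_data PM rd _.
  by rewrite /= kn.
- have [emb1 emb2] := embeds_seq emb.
  move=> s1 s2 l1 l2 s1' s2' [l11 [t1 [l12 [r11 r12 ->]]]].
  move=> [l21 [t2 [l22 [r21 r22 ->]]]]; rewrite redirect_first_seq => ag.
  have [ag1 w1] := IH1 _ _ emb1 _ _ _ _ _ _ r11 r21 ag.
  have [ag2 w2] := IH2 _ _ emb2 _ _ _ _ _ _ r12 r22 ag1.
  by split=> //; apply: cat.
- have [[n rel]|] := pselect (exists n, relevant (h n)); last first.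
    exact: agree_runs_irrelevant.
  have [emb1 emb2] := embeds_if emb; have kb := kind_if_branch emb.
  have kj := embeds_kind emb IfJoin; rewrite /= in kj.
  have agJ t1 t2 : agree (Some (h IfJoin)) t1 t2 -> agree e t1 t2.
    by apply: agree_step; rewrite /= kj //; left.
  move=> s1 s2 l1 l2 s1' s2' r1 r2 /= ag.
  have Eeq : eval s1 E = eval s2 E.
    apply: (eval_agree ag) => y yE.
    by apply: (relevant_control rel (BP_if n emb)); rewrite /= kb.
  have nb : assigned (Inner (h IfBranch)) = None by rewrite /= kb.
  case: r1 => [[E1 r1]|[E1 r1]]; case: r2 => [[E2 r2]|[E2 r2]];
    try by move: Eeq; rewrite E1 E2.
  + have [|ag' w] := IH1 _ _ emb1 _ _ _ _ _ _ r1 r2.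
      by apply: agree_step nb ag; rewrite kb; left.
    by split=> //; apply: agJ.
  + have [|ag' w] := IH2 _ _ emb2 _ _ _ _ _ _ r1 r2.
      by apply: agree_step nb ag; rewrite kb; right; left.
    by split=> //; apply: agJ.
- by move=> s1 s2 l1 l2 s1' s2' [-> ->] [-> ->].
- have [[n rel]|] := pselect (exists n, relevant (h n)); last first.
    exact: agree_runs_irrelevant.
  have emb1 := embeds_while emb; have kb := kind_while_branch emb.
  have kj := embeds_kind emb WhJoin; rewrite /= in kj.
  have nb : assigned (Inner (h WhBranch)) = None by rewrite /= kb.
  have agJ t1 t2 : agree (Some (h WhBranch)) t1 t2 -> agree e t1 t2.
    move=> ag; have : agree (Some (h WhJoin)) t1 t2.
      by apply: agree_step nb ag; rewrite kb; right; left.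
    by apply: agree_step; rewrite /= kj //; left.
  have Eeq t1 t2 : agree (Some (h WhBranch)) t1 t2 -> eval t1 E = eval t2 E.
    move=> ag; apply: (eval_agree ag) => y yE.
    by apply: (relevant_control rel (BP_while n emb)); rewrite /= kb.
  (* Induction on the first run, for every second run: by [Eeq] both loops stop or continue
     together, and each iteration restores agreement at the branch node. *)
  move=> s1 s2 l1 l2 s1' s2' /= r1; elim: r1 s2 l2 s2' => {s1 l1 s1'}
    [s1 E1|s1 l1 t1 l1' s1' E1 b1 _ IHl] s2 l2 s2' r2 ag;
    move: (Eeq _ _ ag); rewrite E1; case: r2 ag
    => {s2 l2 s2'} [s2 E2|s2 l2 t2 l2' s2' E2 b2 r2] ag; rewrite ?E2 // => _.
  + by split=> //; apply: agJ.
  + have [|ag1 w1] := IH _ _ emb1 _ _ _ _ _ _ b1 b2.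
      by apply: agree_step nb ag; rewrite kb; left.
    have [ag2 w2] := IHl _ _ _ r2 ag1.
    by split=> //; apply: cat.
- move=> s1 s2 l1 l2 s1' s2' [a1 /= [ea1 _ _ -> ->]] [a2 /= [ea2 _ _ -> ->]] ag.
  have kn := embeds_kind emb tt; rewrite /= in kn.
  have ie : List.In e (successors (kind_of (h tt))) by rewrite kn; left.
  have sn : is_sample (Inner (h tt)) by rewrite /= kn.
  (* The common address lies in [A], where the traces coincide. This is used both when the sampled
     value is live and when the node is [n0]. *)
  have tr_a : (forall y, vars E0 y -> P (Inner (h tt)) y) ->
      addresses (Inner (h tt)) `<=` A -> tr1 a1 = tr2 a2.
    move=> PE sub; have : eval s1 E0 = eval s2 E0 by apply: eval_agree ag PE.
    rewrite ea1 ea2 => -[<-]; apply/tr_eq/sub; split=> //.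
    by exists s1; rewrite /= kn.
  split=> [z lz /=|].
    have [zx|zx] := eqVneq z x; last first.
      by apply/ag/(live_step ie) => //=; rewrite kn => -[/esym/eqP]; apply/negP.
    have [|M PM rd] := live_RD ie _ lz; first by rewrite /= kn zx.
    apply: tr_a; last exact: P_addresses PM rd sn.
    by move=> y yE; apply: P_data PM rd _; rewrite /= kn.
  (* Only at [n0] does the event count; there [P_sample] also covers the arguments of the
     distribution, so the two density factors are equal. *)
  rewrite /=; case: asboolP => // -[eq].
  have Pn E y : (E0 |` range Es) E -> vars E y -> P (Inner (h tt)) y.
    by move=> EE yE; rewrite eq; apply: P_sample yE; rewrite -eq /= kn.
  have -> : tr1 a1 = tr2 a2.
    apply: tr_a; last by rewrite eq.
    by move=> y; apply: Pn; left.
  suff -> : (fun i => eval s1 (Es i)) = (fun i => eval s2 (Es i)) by [].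
  apply/funext => i; apply: (eval_agree ag) => y; apply: Pn; right.
  by exists i.
Qed.

End TwoRuns.
End Noninterference.

End Factorization.

(** * The factors and their product *)

Theorem theorem2 (R : realType) (Var : finType) (L : builtins R)
  (S : stmt Var L) (K : nat) (N : 'I_K -> node (cfg S))
  (N_inj : injective N)
  (N_all : forall n : node (cfg S), is_sample n <-> exists k, N k = n) :
  let A (k : 'I_K) : set address :=
    addresses (N k)
    `|` \bigcup_(E in sample_exprs (N k)) prov (N k) E
    `|` \bigcup_(B in BP (N k)) prov B (condexp B) in
  exists p : 'I_K -> trace R -> {nonneg R},
    (forall k, restricted (A k) {nonneg R} (p k)) /\
    forall tr : trace R, pS S tr <> None ->
      [/\ pS S tr = pG (cfg S) tr,
          pG (cfg S) tr = pG (unrolled_cfg S) tr &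
          omap (fun q : {nonneg R} => q%:num) (pG (unrolled_cfg S) tr)
            = Some (\prod_(k < K) (p k tr)%:num)].
Proof.
move=> A.
(* The weights of [N k] in terminating runs on traces agreeing with [tr]: a
   singleton by noninterference, unless there is no such run. *)
pose factor k tr := [set w | exists tr' l s', [/\
  forall a, A k a -> tr a = tr' a,
  run tr' (@Inner _ _ _ (cfg S)) (init_state R Var) l s' & w = weight (N k) l]].
have factorP k tr l s : run tr (@Inner _ _ _ (cfg S)) (init_state R Var) l s ->
    xget (1%:nng : {nonneg R}) (factor k tr) = weight (N k) l.
  (* The run on [tr] itself is in the set, so the default [1] is not taken; the chosen weight comes
     from a run on some [tr'] agreeing with [tr] on [A k]. *)
  move=> r; case: xgetP => [w ->|/(_ (weight (N k) l)) []].
  2: by exists tr, l, s.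
  move=> [tr' [l' [s' [eq r' ->]]]].
  have : is_sample (N k) by apply/N_all; exists k.
  case Nk : (N k) => [||n0] // sn.
  (* The pairs generating the two provenance unions in [A k]: those of the sample expressions and
     those of the controlling conditions. *)
  pose P M z := (exists E y, [/\ sample_exprs (N k) E, vars E y &
      prov_pairs (N k) y M z]) \/
    (exists B y, [/\ BP (N k) B, vars (condexp B) y & prov_pairs B y M z]).
  (* The program is embedded in its own graph by the identity, with END as exit; both runs start in
     [init_state], so they agree initially. *)
  apply/esym; apply: (@run_agree _ _ _ _ n0 (A k) P _ _ _ _ _ _ tr tr' eq _ id
    None (embeds_id _) _ _ _ _ _ _ r r' _).2.
  - move=> M z N' y [[E [x [sE xE pr]]]|[B [x [bp xB pr]]]] rd yN.
    + by left; exists E, x; split=> //; apply: prov_data pr rd yN.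
    + by right; exists B, x; split=> //; apply: prov_data pr rd yN.
  - move=> M z N' B' y [[E [x [sE xE pr]]]|[B [x [bp xB pr]]]] rd bp' yB.
    + by left; exists E, x; split=> //; apply: prov_control pr rd bp' yB.
    + by right; exists B, x; split=> //; apply: prov_control pr rd bp' yB.
  - move=> M z N' [[E [x [sE xE pr]]]|[B [x [bp xB pr]]]] rd sN' a aN'.
    + by left; right; exists E => //; exists x => //; exists M, z, N'.
    + by right; exists B => //; exists x => //; exists M, z, N'.
  - move=> E y; rewrite -Nk => sE yE; left; exists E, y; split=> //.
    exact: prov_start.
  - move=> B y; rewrite -Nk => bp yB; right; exists B, y; split=> //.
    exact: prov_start.
  - by move=> a; rewrite -Nk => aN; left; left.
  - by [].
exists (fun k tr => xget 1%:nng (factor k tr)); split.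
  (* Traces agreeing on [A k] define the same set of weights, hence the same choice from it. *)
  move=> k tr tr' eq; congr xget; apply/seteqP.
  by split=> w [tr0 [l [s [eq0 r ->]]]]; exists tr0, l, s; split=> // a Aa;
    [rewrite -eq|rewrite eq] => //; apply: eq0.
move=> tr def.
have [s ex] : exists s, exec tr (init_state R Var) S s.
  apply: contrapT => nex; apply: def; rewrite /pS /final_density.
  by case: pselect.
have [l r] := exec_run ex (@Inner _ _ _ (cfg S)).
have [simG simH] := run_simulates tr (@Inner _ _ _ (cfg S)).
have pSE : pS S tr = Some (density s).
  by apply: (final_densityE ex) => s' ex'; apply: exec_det ex' ex.
rewrite pSE (simulates_pG simG (ex_intro _ l r)).
rewrite (simulates_pG simH (ex_intro _ l r)); split=> //=; congr Some.
rewrite (run_density N_inj _ (embeds_id _) r) => [|n]; last by move/N_all.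
by rewrite mul1r; apply: eq_bigr => k _; rewrite (factorP _ _ _ _ r).
Qed.
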